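(* Let $p$ be an even positive integer, let $\mu=\frac{p^2}{4}+2p+2$, $\gamma=2\mu-\left(\frac{p}{2}+4\right)$, and let $S(p)=\langle \mu,\gamma,\gamma+1\rangle_{p\mu}$. Then the Eliahou number of $S(p)$ is $$\mathrm{E}(S(p))=\frac{p}{4}\left(1-\frac{p}{2}\right).$$
   Context: A numerical semigroup $S$ is a submonoid of $(\mathbb N,+)$ with finite complement in $\mathbb N$. For integers $a_1,\dots,a_r$ and $t$, $\langle a_1,\dots,a_r\rangle_t$ denotes the smallest numerical semigroup containing $a_1,\dots,a_r$ and all integers $\ge t$. For a numerical semigroup $S$: the conductor $c=c(S)$ is the smallest integer such that all integers $\ge c$ lie in $S$; the multiplicity $m=m(S)$ is the least positive element of $S$; $L=L(S)=\{s\in S: s<c\}$ is the set of left elements; $P=P(S)$ is the set of minimal generators (primitive elements) of $S$; $q=q(S)=\lceil c/m\rceil$; $\rho=\rho(S)=qm-c$; $I_q=\{z\in\mathbb Z: c\le z<c+m\}$; $D_q=I_q\setminus P$ (the decomposable elements of $S$ in $I_q$). The Eliahou number of $S$ is $\mathrm{E}(S)=|P\cap L|\,|L|-q\,|D_q|+\rho$. *)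

(* Defs.v *)
From mathcomp Require Import all_boot all_order all_algebra finmap.
From mathcomp Require Import boolp classical_sets functions cardinality.
From mathcomp Require Import lra zify.

Set Implicit Arguments.
Unset Strict Implicit.
Unset Printing Implicit Defensive.

Import Order.TTheory GRing.Theory Num.Theory.

Local Open Scope classical_set_scope.

Definition submonoid (M : set nat) : Prop :=
  M 0 /\ (forall a b, M a -> M b -> M (a + b)).

Definition numerical_semigroup (S : set nat) : Prop :=
  submonoid S /\ finite_set (~` S).

Record numsgp := NumSgp {
  numsgp_set :> set nat;
  numsgpP : numerical_semigroup numsgp_set }.

Lemma finite_set_bounded (A : set nat) :
  finite_set A -> exists n, forall x, A x -> x < n.
Proof.
move=> /finite_fsetP[X ->]; exists (\max_(x <- X) x).+1 => x /= Xx.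
by rewrite ltnS (leq_bigmax_seq (F := id)).
Qed.

Lemma cofinite_conductor (S : set nat) : finite_set (~` S) ->
  exists n, `[< forall z, n <= z -> S z >].
Proof.
move=> /finite_set_bounded[n Hn]; exists n; apply/asboolP => z nz.
by apply: contrapT => /Hn; rewrite ltnNge nz.
Qed.

Definition conductor (S : numsgp) : nat :=
  ex_minn (cofinite_conductor (numsgpP S).2).

Lemma cofinite_multiplicity (S : set nat) : finite_set (~` S) ->
  exists n, `[< 0 < n /\ S n >].
Proof.
move=> /cofinite_conductor[n /asboolP Sn]; exists n.+1.
by apply/asboolP; split=> //; apply: Sn.
Qed.

Definition multiplicity (S : numsgp) : nat :=
  ex_minn (cofinite_multiplicity (numsgpP S).2).

Definition left_elements (S : numsgp) : set nat :=
  S `&` [set s | s < conductor S].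

Definition primitives (S : set nat) : set nat :=
  [set x | [/\ S x, 0 < x &
     ~ exists a b, [/\ S a, S b, 0 < a, 0 < b & x = a + b]]].

Definition generates (A M : set nat) : Prop := smallest submonoid A = M.

Lemma submonoid_smallest (A : set nat) : submonoid (smallest submonoid A).
Proof.
split=> [M [[M0 _] _]//|a b Sa Sb M MA].
by have [[_ MD] _] := MA; apply: MD; [apply: Sa|apply: Sb].
Qed.

(* [primitives S] is the unique minimal generating set of S: it generates S,
   and it is contained in every generating set. *)
Lemma generates_primitives (S : set nat) :
  submonoid S -> generates (primitives S) S.
Proof.
move=> Ssub; apply/seteqP; split; first by apply: smallest_sub => // x [].
have [G0 GD] := submonoid_smallest (primitives S).
elim/ltn_ind => x IH Sx; have [->//|x0] := posnP x.
have [[a [b [Sa Sb a0 b0 xab]]]|nab] :=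
  pselect (exists a b, [/\ S a, S b, 0 < a, 0 < b & x = a + b]).
  by rewrite xab; apply: GD; apply: IH => //; lia.
by apply: sub_gen_smallest; split.
Qed.

Lemma primitives_min (S A : set nat) :
  generates A S -> primitives S `<=` A.
Proof.
move=> gA x [Sx x0 nab]; apply: contrapT => nAx.
have Ssub : submonoid S by rewrite -gA; apply: submonoid_smallest.
have AS : A `<=` S by rewrite -gA; apply: sub_gen_smallest.
suff /(_ x) : S `<=` [set y | S y /\ y <> x] by move=> /(_ Sx)[].
rewrite -{1}gA; apply: smallest_sub => [|y Ay].
  case: Ssub => S0 SD; split=> [|a b [Sa ax] [Sb bx]].
    by split=> //; move: x0 => /[swap] <-.
  split; first exact: SD.
  move=> abx; apply: nab; exists a, b; split=> //; lia.
by split; [exact: AS|move=> yx; apply: nAx; rewrite -yx].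
Qed.

Definition depth (S : numsgp) : int :=
  Num.ceil ((conductor S)%:R / (multiplicity S)%:R : rat)%R.

Definition rho (S : numsgp) : int :=
  (depth S * (multiplicity S)%:Z - (conductor S)%:Z)%R.

Definition last_interval (S : numsgp) : set nat :=
  [set z | conductor S <= z < conductor S + multiplicity S].

Definition decomposables (S : numsgp) : set nat :=
  last_interval S `\` primitives S.

Lemma finite_ltn n : finite_set [set z | z < n].
Proof. exact: finite_II. Qed.

Lemma finite_left_elements S : finite_set (left_elements S).
Proof. by apply: sub_finite_set (finite_ltn (conductor S)) => x []. Qed.

Lemma finite_decomposables S : finite_set (decomposables S).
Proof.
apply: sub_finite_set (finite_ltn (conductor S + multiplicity S)) => x [].
by move=> /andP[].
Qed.

(* [fset_set A] is the empty set when A is infinite; the sets counted below are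
   finite by [finite_left_elements] and [finite_decomposables]. *)
Definition card (A : set nat) : nat := #|` fset_set A|.

Definition eliahou (S : numsgp) : int :=
  ((card (primitives S `&` left_elements S))%:Z * (card (left_elements S))%:Z
   - depth S * (card (decomposables S))%:Z + rho S)%R.

Definition gens (s : seq nat) (t : nat) : set nat :=
  [set x | x \in s \/ t <= x].

Lemma numerical_semigroup_gen (s : seq nat) (t : nat) :
  numerical_semigroup (smallest numerical_semigroup (gens s t)).
Proof.
split; first split.
- by move=> M [[[]]].
- move=> a b Sa Sb M MA; have [[[_ MD] _] _] := MA.
  by apply: MD; [apply: Sa|apply: Sb].
apply: sub_finite_set (finite_ltn t) => x nSx /=.
rewrite ltnNge; apply/negP => tx; apply: nSx.
by apply: sub_gen_smallest; right.
Qed.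

Definition numsgp_gen (s : seq nat) (t : nat) : numsgp :=
  NumSgp (numerical_semigroup_gen s t).

Definition mu (p : nat) : nat := p ^ 2 %/ 4 + 2 * p + 2.

Definition gamma (p : nat) : nat := 2 * mu p - (p %/ 2 + 4).

(* For p even and positive, the divisions in [mu] and [gamma] are exact and the
   subtraction is not truncated. *)
Lemma muE p : ~~ odd p -> ((mu p)%:R = p%:R ^+ 2 / 4 + 2 * p%:R + 2 :> rat)%R.
Proof.
move=> pe; have [k ->] : exists k, p = 2 * k by exists (p %/ 2); lia.
rewrite /mu expnMn (_ : 2 ^ 2 = 4)// mulKn//.
by rewrite -mulnn !natrD !natrM; lra.
Qed.

Lemma gammaE p : 0 < p -> ~~ odd p ->
  ((gamma p)%:R = 2 * (mu p)%:R - (p%:R / 2 + 4) :> rat)%R.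
Proof.
move=> p0 pe; have [k pk] : exists k, p = 2 * k by exists (p %/ 2); lia.
have kE : p %/ 2 = k by lia.
rewrite /gamma natrB; last by rewrite /mu; lia.
by rewrite kE natrD natrM pk natrM; lra.
Qed.

Definition Sp (p : nat) : numsgp :=
  numsgp_gen [:: mu p; gamma p; (gamma p).+1] (p * mu p).

(* Main.v *)
(* Write p = 2k. Every element of the monoid generated by mu, gamma, gamma + 1
   has the form i mu - d, where d lies in the interval [b (k+3), b (k+4)] for
   some b <= i/2. These intervals are pairwise disjoint for b <= k + 1, and they
   lie below mu for b <= k; hence the elements up to p mu are listed without
   repetition by the triples (i, b, d) with i <= 2k. The decomposables in
   [p mu, (p+1) mu) come from i = 2k with d = 0, from i = 2k + 1 with d > 0, and
   from i = 2k + 2 with b = k + 1, the only b for which d exceeds mu. *)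
From mathcomp Require Import all_boot all_order all_algebra finmap.
From mathcomp Require Import boolp classical_sets cardinality.
From mathcomp Require Import ring zify.
Require Import Defs.

Set Implicit Arguments.
Unset Strict Implicit.
Unset Printing Implicit Defensive.

Import Order.TTheory GRing.Theory Num.Theory.

Local Open Scope classical_set_scope.

(** * Criteria for cardinality, conductor and multiplicity *)

Lemma card_uniq (A : set nat) (s : seq nat) :
  uniq s -> (forall x, A x <-> x \in s) -> card A = size s.
Proof.
move=> us As; rewrite /card.
have -> : A = [set` [fset x in s]%fset].
  by apply/seteqP; split=> x /=; rewrite inE As.
by rewrite set_fsetK card_fseq undup_id.
Qed.

(** A conductor below n would put n - 1 in S, so this single gap suffices. *)
Lemma conductor_eq (S : numsgp) n : (forall z, n < z -> numsgp_set S z) ->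
  numsgp_set S n -> (0 < n -> ~ numsgp_set S n.-1) -> conductor S = n.
Proof.
move=> Sgt Sn Spred; rewrite /conductor; case: ex_minnP => c /asboolP cS cmin.
apply/eqP; rewrite eqn_leq cmin; last first.
  by apply/asboolP => z; rewrite leq_eqVlt => /predU1P[<-//|/Sgt].
rewrite leqNgt; apply/negP => cn; apply: Spred; first by lia.
by apply: cS; lia.
Qed.

Lemma multiplicity_eq (S : numsgp) n : 0 < n -> numsgp_set S n ->
  (forall z, 0 < z -> numsgp_set S z -> n <= z) -> multiplicity S = n.
Proof.
move=> n0 Sn Smin; rewrite /multiplicity; case: ex_minnP => m /asboolP[m0 Sm].
move=> mmin; apply/eqP; rewrite eqn_leq Smin// mmin//.
by apply/asboolP.
Qed.

Lemma submonoid_mul (M : set nat) n a : submonoid M -> M a -> M (n * a).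
Proof.
by move=> [M0 MD] Ma; elim: n => [//|n IH]; rewrite mulSn; apply: MD.
Qed.

(** * The semigroup described by levels and offsets *)

Lemma muD k : mu (2 * k) = k * k + 4 * k + 2.
Proof. by rewrite /mu expnMn (_ : 2 ^ 2 = 4)// mulKn//; lia. Qed.

Lemma gammaD k : gamma (2 * k) = 2 * mu (2 * k) - (k + 4).
Proof. by rewrite /gamma mulKn. Qed.

Section Levels.
Variable k : nat.
Hypothesis k_gt0 : 0 < k.
Let M := mu (2 * k).
Let T : numsgp := Sp (2 * k).
Let S : set nat := T.

Let ME : M = k * k + 4 * k + 2. Proof. exact: muD. Qed.

(** As gamma = 2 mu - (k + 4), b counts the summands gamma and gamma + 1, e those equal to gamma,
    and i - 2b those equal to mu. The additive form avoids truncated subtraction. *)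
Definition leveled x :=
  exists i b e, [/\ 2 * b <= i, e <= b & x + (b * (k + 3) + e) = i * M].

Lemma leveledD x y : leveled x -> leveled y -> leveled (x + y).
Proof.
move=> [i [b [e [bi eb xE]]]] [i' [b' [e' [bi' eb' yE]]]].
by exists (i + i'), (b + b'), (e + e'); split; lia.
Qed.

Lemma Sp_submonoid : submonoid S.
Proof. by case: (numsgpP S). Qed.

Lemma leveled_Sp x : leveled x -> S x.
Proof.
move=> [i [b [e [bi eb xE]]]].
have gE := gammaD k; rewrite -/M in gE.
have -> : x = (i - 2 * b) * M
    + (e * gamma (2 * k) + (b - e) * (gamma (2 * k)).+1).
  have [j ij] : exists j, i = j + 2 * b by exists (i - 2 * b); lia.
  have [f bf] : exists f, b = e + f by exists (b - e); lia.
  have {}gE : gamma (2 * k) + k + 4 = 2 * M by nia.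
  rewrite ij bf !addnK addKn; rewrite ij bf in xE.
  nia.
have [S0 SD] := Sp_submonoid.
have Sgen y : y \in [:: M; gamma (2 * k); (gamma (2 * k)).+1] -> S y.
  by move=> ys; apply: sub_gen_smallest; left.
by apply: (SD); [|apply: (SD)]; apply: (submonoid_mul _ Sp_submonoid);
  apply: Sgen; rewrite !inE eqxx ?orbT.
Qed.

Lemma leveled_gens x : x \in [:: M; gamma (2 * k); (gamma (2 * k)).+1] ->
  leveled x.
Proof.
have gE := gammaD k; rewrite -/M in gE.
rewrite !inE => /or3P[] /eqP ->.
- by exists 1, 0, 0; split; lia.
- by exists 2, 1, 1; split; nia.
- by exists 2, 1, 0; split; nia.
Qed.

(** The right-hand side is itself a numerical semigroup containing the generators, so minimality
    puts S inside it. *)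
Lemma SpP x : S x <-> leveled x \/ 2 * k * M <= x.
Proof.
split=> [Sx|[/leveled_Sp//|kx]]; last by apply: sub_gen_smallest; right.
apply: (Sx [set y | leveled y \/ 2 * k * M <= y]); split; last first.
  by move=> y [/leveled_gens|]; [left|right].
split; first split.
- by left; exists 0, 0, 0; split.
- move=> a b /= [la|la] [lb|lb]; [by left; apply: leveledD|right..]; lia.
- apply: sub_finite_set (finite_ltn (2 * k * M)) => x' nSx /=.
  by rewrite ltnNge; apply/negP => tx; apply: nSx; right.
Qed.

(** * Bounds on the level; conductor, multiplicity and depth *)

Lemma level_le i b e x : 2 * b <= i -> e <= b ->
  x + (b * (k + 3) + e) = i * M -> x <= 2 * k * M -> i <= 2 * k.
Proof.
move=> bi eb xE xk; rewrite leqNgt; apply/negP => ki.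
(* The estimate d <= i (k + 4) / 2, used from 2k + 2 on, falls short by k / 2 at i = 2k + 1; there
   integrality gives b <= k. *)
have [iE|ik] : i = 2 * k + 1 \/ 2 * k + 2 <= i by lia.
  have bk : b <= k by lia.
  nia.
have h : 2 * (i * M) <= 4 * k * M + i * (k + 4) by nia.
have : (2 * k + 2) * (2 * M - (k + 4)) <= i * (2 * M - (k + 4)).
  by rewrite leq_mul2r ik orbT.
rewrite !mulnBr; nia.
Qed.

Lemma level_lt i b e x : 2 * b <= i -> e <= b ->
  x + (b * (k + 3) + e) = i * M -> x < (2 * k + 1) * M -> i <= 2 * k + 2.
Proof.
move=> bi eb xE xk; rewrite leqNgt; apply/negP => ki.
(* Again d <= i (k + 4) / 2; the margin at i = 2k + 3 is 2k^2 + 5k - 4 > 0. *)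
have h : 2 * (i * M) < 2 * ((2 * k + 1) * M) + i * (k + 4) by nia.
have : (2 * k + 3) * (2 * M - (k + 4)) <= i * (2 * M - (k + 4)).
  by rewrite leq_mul2r orbC; apply/orP; left; lia.
rewrite !mulnBr; nia.
Qed.

(** The largest such offset is k (k + 4) = M - 2. Hence for i <= 2k + 1 level i lies in ((i - 1) M,
    i M], and x determines i. *)
Lemma offset_lt b e : b <= k -> e <= b -> b * (k + 3) + e < M.
Proof. by move=> bk eb; nia. Qed.

Lemma Sp_ge x : 0 < x -> S x -> M <= x.
Proof.
move=> x0 /SpP[[i [b [e [bi eb xE]]]]|]; last by nia.
rewrite leqNgt; apply/negP => xM.
have ik : i <= 2 * k by apply: level_le xE _ => //; nia.
have dM : b * (k + 3) + e < M by apply: offset_lt; lia.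
have i1 : i = 1 by nia.
have b0 : b = 0 by lia.
by subst i b; lia.
Qed.

Lemma conductor_Sp : conductor T = 2 * k * M.
Proof.
apply: conductor_eq => [z kz||c0 /SpP[[i [b [e [bi eb xE]]]]|]]; last by lia.
- by apply/SpP; right; lia.
- by apply/SpP; right.
have ik : i <= 2 * k by apply: level_le xE _ => //; lia.
have dM : b * (k + 3) + e < M by apply: offset_lt; lia.
have iE : i = 2 * k by nia.
(* An offset is 0 or at least k + 3, so it cannot be 1. *)
have d1 : b * (k + 3) + e = 1 by rewrite iE in xE; lia.
by case: b d1 {bi xE dM} eb => [|b]; lia.
Qed.

Lemma multiplicity_Sp : multiplicity T = M.
Proof.
apply: multiplicity_eq; [by lia| |exact: Sp_ge].
by apply/SpP; left; apply: leveled_gens; rewrite inE eqxx.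
Qed.

Lemma depth_Sp : depth T = (2 * k)%:Z%R.
Proof.
rewrite /depth conductor_Sp multiplicity_Sp natrM mulfK; last first.
  by rewrite pnatr_eq0; lia.
by rewrite -[(2 * k)%:R%R]/(((2 * k)%:Z)%:~R : rat)%R intrKceil.
Qed.

Lemma rho_Sp : rho T = 0%R.
Proof.
rewrite /rho depth_Sp conductor_Sp multiplicity_Sp.
by rewrite [X in (_ - X)%R]PoszM subrr.
Qed.

(** * Listing and counting the left elements *)

Definition offsets a n :=
  [seq b * (k + 3) + e | b <- iota a n, e <- iota 0 b.+1].

Lemma offsetsP a n d : reflect
  (exists b e, [/\ a <= b < a + n, e <= b & d = b * (k + 3) + e])
  (d \in offsets a n).
Proof.
apply: (iffP allpairsPdep) => -[b [e]].
  by rewrite !mem_iota => -[? ? ->]; exists b, e; split; lia.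
by move=> [? ? ->]; exists b, e; rewrite !mem_iota; split => //; lia.
Qed.

(** As e <= b < k + 3, the pair (b, e) is quotient and remainder of the offset by k + 3. *)
Lemma offsets_uniq a n : a + n <= k + 3 -> uniq (offsets a n).
Proof.
move=> ank; apply: allpairs_uniq_dep => [|b _|]; [exact: iota_uniq..|].
move=> _ _ /allpairsPdep[b [e [+ + ->]]] /allpairsPdep[b' [e' [+ + ->]]] /=.
rewrite !mem_iota => bn eb bn' eb' eqd.
have bb : b = b'.
  have ek : e < k + 3 by lia.
  have ek' : e' < k + 3 by lia.
  nia.
by subst b'; have -> : e = e' by lia.
Qed.

Lemma size_offsetsS a n :
  size (offsets a n.+1) = size (offsets a n) + (a + n).+1.
Proof.
rewrite /offsets !size_allpairs_dep -(addn1 n) iotaD map_cat sumn_cat /=.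
by rewrite size_iota; lia.
Qed.

Lemma size_offsets0 n : 2 * size (offsets 0 n) = n * n.+1.
Proof. by elim: n => [//|n IH]; rewrite size_offsetsS; lia. Qed.

(** Leaving out the offset 0 serves the decomposables of level 2k + 1. *)
Lemma size_offsets1 n : 2 * size (offsets 1 n) = n * (n + 3).
Proof. by elim: n => [//|n IH]; rewrite size_offsetsS; lia. Qed.

Definition levels n :=
  [seq i * M - d | i <- iota 0 n, d <- offsets 0 (i %/ 2).+1].

Lemma levels_uniq : uniq (levels (2 * k).+1).
Proof.
apply: allpairs_uniq_dep => [|i|]; first exact: iota_uniq.
  by rewrite mem_iota => ik; apply: offsets_uniq; lia.
move=> _ _ /allpairsPdep[i [d [+ + ->]]] /allpairsPdep[i' [d' [+ + ->]]] /=.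
rewrite !mem_iota => ik /offsetsP[b [e [bi eb dE]]].
move=> ik' /offsetsP[b' [e' [bi' eb' dE']]] eqx.
have dM : d < M by rewrite dE; apply: offset_lt; lia.
have dM' : d' < M by rewrite dE'; apply: offset_lt; lia.
(* No truncation occurs: level 0 has only the offset 0. *)
have di : d <= i * M by case: (posnP i) => i0; nia.
have di' : d' <= i' * M by case: (posnP i') => i0; nia.
have ii : i = i' by nia.
by subst i'; have -> : d = d' by lia.
Qed.

Lemma mem_levels x : x \in levels (2 * k).+1 <-> leveled x /\ x <= 2 * k * M.
Proof.
split=> [/allpairsPdep[i [d]]|[[i [b [e [bi eb xE]]]] xk]].
  rewrite mem_iota => -[ik /offsetsP[b [e [bi eb dE]]] ->].
  have dM : d < M by rewrite dE; apply: offset_lt; lia.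
  have di : d <= i * M by case: (posnP i) => i0; nia.
  split; last by nia.
  by exists i, b, e; split; lia.
have ik := level_le bi eb xE xk.
apply/allpairsPdep; exists i, (b * (k + 3) + e).
rewrite mem_iota; split; [lia| |lia].
by apply/offsetsP; exists b, e; split => //; lia.
Qed.

Lemma size_levelsS n :
  size (levels n.+1) = size (levels n) + size (offsets 0 (n %/ 2).+1).
Proof.
rewrite /levels 2!size_allpairs_dep -(addn1 n) iotaD map_cat sumn_cat.
by congr addn; exact: addn0.
Qed.

(** Levels 2j and 2j + 1 each carry (j + 1)(j + 2) / 2 offsets, so the total is twice a tetrahedral
    number. *)
Lemma size_levels n : 3 * size (levels (2 * n)) = n * n.+1 * n.+2.
Proof.
elim: n => [//|n IH]; have := size_offsets0 n.+1.
rewrite (_ : 2 * n.+1 = (2 * n).+2); last by lia.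
rewrite !size_levelsS (_ : 2 * n %/ 2 = n); last by lia.
by rewrite (_ : (2 * n).+1 %/ 2 = n); lia.
Qed.

(** Levels 0 to 2k also list the conductor, with i = 2k and d = 0; its removal accounts for the +
    6. *)
Lemma card_left_Sp : 6 * card (left_elements T) + 6 =
  2 * (k * k.+1 * k.+2) + 3 * (k.+1 * k.+2).
Proof.
have inL : 2 * k * M \in levels (2 * k).+1.
  by apply/mem_levels; split=> //; exists (2 * k), 0, 0; split; lia.
rewrite (@card_uniq _ (rem (2 * k * M) (levels (2 * k).+1))).
- rewrite size_rem//.
  have : 0 < size (levels (2 * k).+1) by case: (levels _) inL.
  have := size_levels k; have := size_offsets0 k.+1.
  by rewrite size_levelsS (_ : 2 * k %/ 2 = k); lia.
- exact: rem_uniq levels_uniq.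
move=> x; rewrite (mem_rem_uniq _ levels_uniq) inE /left_elements.
rewrite conductor_Sp; split=> [[/SpP Sx /= xk]|].
  case: Sx => [lx|]; last by lia.
  by apply/andP; split; [lia|apply/mem_levels; split=> //; lia].
move=> /andP[xk /mem_levels[lx xk']]; split; last by rewrite /=; lia.
by apply/SpP; left.
Qed.

(** * Primitive left elements, and decomposables of the last interval *)

Lemma leveled_decomposable x : leveled x -> 2 * M <= x ->
  exists a b, [/\ S a, S b, 0 < a, 0 < b & x = a + b].
Proof.
move=> [i [b [e [bi eb xE]]]] Mx.
(* Peel off mu if i > 2b, else gamma + 1 if e = 0, else gamma. Each is below 2M, so the rest stays
   positive. *)
case: (ltnP (2 * b) i) => ib.
  exists M, (x - M); split; [| |lia|lia|lia].
    by apply/SpP; left; apply: leveled_gens; rewrite inE eqxx.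
  by apply: leveled_Sp; exists i.-1, b, e; split; nia.
have b0 : 0 < b by nia.
have gM : gamma (2 * k) + k + 4 = 2 * M by have := gammaD k; rewrite -/M; lia.
case: b b0 ib bi eb xE => // b _ ib bi eb xE.
have [j ij] : exists j, i = j + 2 by exists (i - 2); lia.
subst i; have [e0|e0] := posnP e.
  exists (gamma (2 * k)).+1, (x - (gamma (2 * k)).+1); split; try lia.
    by apply: leveled_Sp; apply: leveled_gens; rewrite !inE eqxx !orbT.
  by apply: leveled_Sp; exists j, b, e; split; lia.
case: e e0 eb xE => // e _ eb xE.
exists (gamma (2 * k)), (x - gamma (2 * k)); split; try lia.
  by apply: leveled_Sp; apply: leveled_gens; rewrite !inE eqxx !orbT.
by apply: leveled_Sp; exists j, b, e; split; lia.
Qed.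

(** A primitive left element is below 2M, hence on level 1 or 2; conversely two positive elements
    sum to at least 2M, above every generator. *)
Lemma primitives_left_Sp x : (primitives S `&` left_elements T) x <->
  x \in [:: M; gamma (2 * k); (gamma (2 * k)).+1].
Proof.
have gM := gammaD k; rewrite -/M in gM.
split=> [[[Sx x0 nx] [_ /=]]|xg].
  rewrite conductor_Sp => xk.
  have lx : leveled x by case/SpP: Sx => //; lia.
  have xM : x < 2 * M.
    by rewrite ltnNge; apply/negP => /(leveled_decomposable lx).
  case: (lx) => i [b [e [bi eb xE]]].
  have ik : i <= 2 * k by apply: level_le xE _ => //; nia.
  have dM : b * (k + 3) + e < M by apply: offset_lt; lia.
  have i2 : i <= 2 by nia.
  rewrite !inE; apply/or3P.
  have [b0|b0] := posnP b.
    constructor 1; apply/eqP; have i1 : i = 1 by nia.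
    by subst i b; lia.
  have b1 : b = 1 by lia.
  have i2' : i = 2 by lia.
  subst b i; case: e eb xE {dM} => [|e] eb xE; [constructor 3|constructor 2];
    apply/eqP; lia.
have Sx : S x by apply: leveled_Sp; apply: leveled_gens.
have xM : M <= x < 2 * M by move: xg; rewrite !inE => /or3P[] /eqP ->; nia.
split; split => //; first by lia.
  move=> [a [b [Sa Sb a0 b0 xE]]].
  by have := Sp_ge a0 Sa; have := Sp_ge b0 Sb; lia.
by rewrite /= conductor_Sp; nia.
Qed.

Lemma card_primitives_left_Sp : card (primitives S `&` left_elements T) = 3.
Proof.
have gM := gammaD k; rewrite -/M in gM.
rewrite (card_uniq _ primitives_left_Sp)//= !inE.
by rewrite !negb_or -!andbA; apply/and4P; split => //; apply/eqP; nia.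
Qed.

(** Levels 2k, 2k + 1 and 2k + 2 in turn. On level 2k + 1 the offset 0 would give c + m, just
    outside the interval. On level 2k + 2, since (k + 1)(k + 3) = M + 1, the choice b = k + 1 yields
    the k + 2 integers just below (2k + 1) M. *)
Definition decomposable_seq :=
  2 * k * M :: [seq (2 * k + 1) * M - d | d <- offsets 1 k]
    ++ iota ((2 * k + 1) * M - (k + 2)) (k + 2).

Lemma decomposable_seq_mid x :
  x \in [seq (2 * k + 1) * M - d | d <- offsets 1 k] ->
  2 * k * M < x < (2 * k + 1) * M - (k + 2).
Proof.
move=> /mapP[d /offsetsP[b [e [bk eb dE]]] ->].
have dM : d < M by rewrite dE; apply: offset_lt; lia.
have d3 : k + 3 <= d by nia.
by nia.
Qed.

Lemma decomposable_seq_uniq : uniq decomposable_seq.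
Proof.
have M0 : k + 2 < M by nia.
rewrite /decomposable_seq /= cat_uniq iota_uniq andbT mem_cat negb_or -!andbA.
apply/and4P; split.
- by apply/negP => /decomposable_seq_mid; lia.
- by rewrite mem_iota; nia.
- rewrite map_inj_in_uniq; first by apply: offsets_uniq; lia.
  move=> d d' /offsetsP[b [e [bk eb dE]]] /offsetsP[b' [e' [bk' eb' dE']]].
  have dM : d < M by rewrite dE; apply: offset_lt; lia.
  have dM' : d' < M by rewrite dE'; apply: offset_lt; lia.
  by nia.
- apply/hasPn => x; rewrite mem_iota => xk.
  by apply/negP => /decomposable_seq_mid; lia.
Qed.

Lemma mem_decomposable_seq x : x \in decomposable_seq <->
  leveled x /\ 2 * k * M <= x < (2 * k + 1) * M.
Proof.
rewrite inE mem_cat mem_iota; split.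
  move=> /or3P[/eqP ->|xd|xi].
  - by split; [exists (2 * k), 0, 0; split; lia|nia].
  - split; last by have := decomposable_seq_mid xd; lia.
    case/mapP: xd => d /offsetsP[b [e [bk eb dE]]] ->.
    have dM : d < M by rewrite dE; apply: offset_lt; lia.
    by exists (2 * k + 1), b, e; split; nia.
  - have M0 : k + 2 < M by nia.
    split; last by nia.
    (* Here x = (2k + 2) M - (M + 1 + e), solved for e. *)
    exists (2 * k + 2), k.+1, ((2 * k + 1) * M - x.+1); split; [lia..|].
    by nia.
move=> [[i [b [e [bi eb xE]]]] /andP[kx xk]].
have ik := level_lt bi eb xE xk.
have [i2|] : i <= 2 * k \/ 2 * k < i by lia.
  apply/or3P; constructor 1; apply/eqP.
  have iM : i * M <= 2 * k * M by rewrite leq_mul2r i2 orbT.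
  by lia.
move=> i2; have [iE|iE] : i = 2 * k + 1 \/ i = 2 * k + 2 by lia.
  apply/or3P; constructor 2; apply/mapP; exists (b * (k + 3) + e); last first.
    by subst i; lia.
  apply/offsetsP; exists b, e; split => //.
  subst i; case: b bi eb xE => [|b] bi eb xE; last by lia.
  by lia.
apply/or3P; constructor 3; subst i.
have bE : b = k.+1.
  have [bk|] : b <= k \/ b = k.+1 by lia.
    by have := offset_lt bk eb; nia.
  by [].
by subst b; nia.
Qed.

(** All of the interval lies in S, so [leveled] is what detects decomposability: two positive
    summands are at least M each, hence both below 2kM and leveled. *)
Lemma decomposables_Sp x : decomposables T x <-> x \in decomposable_seq.
Proof.
rewrite mem_decomposable_seq /decomposables /last_interval.
rewrite conductor_Sp multiplicity_Sp.
rewrite (_ : (2 * k + 1) * M = 2 * k * M + M); last by lia.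
split=> [[/= xk nP]|[lx xk]]; split=> //.
  apply: contrapT => nl; apply: nP; split; [by apply/SpP; right; lia|nia|].
  move=> [a [b [Sa Sb a0 b0 xE]]]; apply: nl; rewrite xE.
  have aM := Sp_ge a0 Sa; have bM := Sp_ge b0 Sb.
  by apply: leveledD; [case/SpP: Sa|case/SpP: Sb] => //; lia.
by move=> [_ _]; apply; apply: leveled_decomposable => //; nia.
Qed.

Lemma card_decomposables_Sp :
  2 * card (decomposables T) = (k + 2) * (k + 3).
Proof.
rewrite (card_uniq decomposable_seq_uniq decomposables_Sp).
rewrite /= size_cat size_map size_iota; have := size_offsets1 k; lia.
Qed.

(** The cubic terms cancel: 6|L| = 2k^3 + 9k^2 + 13k and 4k|D| = 2k^3 + 10k^2 + 12k. *)
Lemma eliahou_Sp : (2 * eliahou T = k%:Z * (1 - k%:Z))%R.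
Proof.
rewrite /eliahou card_primitives_left_Sp depth_Sp rho_Sp.
have := card_left_Sp; have := card_decomposables_Sp.
move: (card _) => D; move: (card _) => L DE LE; nia.
Qed.

End Levels.

Theorem theorem3p20 (p : nat) (p_gt0 : (0 < p)%N) (p_even : ~~ odd p) :
  ((eliahou (Sp p))%:~R = p%:R / 4 * (1 - p%:R / 2) :> rat)%R.
Proof.
have [k pk] : exists k, p = 2 * k by exists (p %/ 2); lia.
have k0 : 0 < k by lia.
rewrite pk; have /(congr1 (fun z : int => z%:~R : rat)%R) := eliahou_Sp k0.
rewrite !rmorphM rmorphB /= natrM => E.
(* For p = 2k the target is k (1 - k) / 2; doubling it matches [E]. *)
apply: (mulfI (_ : 2 != 0 :> rat)%R) => //.
rewrite [LHS]E -[(k%:Z)%:~R%R]/(k%:R : rat)%R; by field.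
Qed.
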